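(* Let $n\geq 5$. The normal closure in $B'_n$ of the element $\sigma_2\sigma_1^{-1}$ is $B'_n$, and the normal closure in $B'_n$ of the element $\sigma_3\sigma_1^{-1}$ is $B'_n$.
   Context: $B_n$ denotes the Artin braid group on $n$ strands, with standard generators $\sigma_1,\dots,\sigma_{n-1}$ and relations $\sigma_i\sigma_{i+1}\sigma_i=\sigma_{i+1}\sigma_i\sigma_{i+1}$ for $1\le i\le n-2$ and $\sigma_i\sigma_j=\sigma_j\sigma_i$ for $|i-j|\geq 2$. $B'_n=[B_n,B_n]$ is its commutator subgroup. The normal closure in $B'_n$ of an element $x\in B'_n$ is the smallest subgroup of $B'_n$ that contains $x$ and is normal in $B'_n$ (i.e. only conjugation by elements of $B'_n$ is used). *)

(* Defs.v *)
(* MathComp, with the classical-sets layer of MathComp-Analysis. *)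
From HB Require Import structures.
From mathcomp Require Import all_boot all_classical.

Set Implicit Arguments.
Unset Strict Implicit.
Unset Printing Implicit Defensive.

Local Open Scope group_scope.
Local Open Scope classical_set_scope.
Local Open Scope quotient_scope.

Section Subgroups.
Variable G : groupType.
Implicit Types H K : set G.

Definition is_subgroup H : Prop := group_closed [in H].

Definition is_normal_in H K : Prop :=
  [/\ is_subgroup K, K `<=` H & forall x h, K x -> H h -> K (x ^ h)].

Definition commutator_subgroup : set G :=
  smallest is_subgroup [set g | exists x y : G, g = [~ x, y]].

(* Meant for x in the subgroup H, so that H itself is among the sets being
   intersected. *)
Definition normal_closure H (x : G) : set G :=
  smallest (is_normal_in H) [set x].

End Subgroups.

Arguments commutator_subgroup : clear implicits.

Section BraidGroup.
Variable n : nat.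

Definition gen_index : Type := {i : nat | 0 < i < n}%N.

(* The letter (i, false) stands for sigma_i, and (i, true) for its inverse. *)
Definition letter : Type := (gen_index * bool)%type.

Definition inv_letter (l : letter) : letter := (l.1, ~~ l.2).

Inductive braid_eq : seq letter -> seq letter -> Prop :=
| braid_eq_refl u : braid_eq u u
| braid_eq_sym u v : braid_eq u v -> braid_eq v u
| braid_eq_trans v u w : braid_eq u v -> braid_eq v w -> braid_eq u w
| braid_eq_cat u u' v v' :
    braid_eq u u' -> braid_eq v v' -> braid_eq (u ++ v) (u' ++ v')
| braid_eq_cancel l : braid_eq [:: l; inv_letter l] [::]
| braid_eq_braid (i j : gen_index) : val j = (val i).+1 ->
    braid_eq [:: (i, false); (j, false); (i, false)]
             [:: (j, false); (i, false); (j, false)]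
| braid_eq_comm (i j : gen_index) :
    ((val i).+2 <= val j)%N || ((val j).+2 <= val i)%N ->
    braid_eq [:: (i, false); (j, false)] [:: (j, false); (i, false)].

Definition braid_eqb (u v : seq letter) : bool := `[< braid_eq u v >].

Lemma braid_eqb_refl : reflexive braid_eqb.
Proof. by move=> u; apply/asboolP/braid_eq_refl. Qed.

Lemma braid_eqb_sym : symmetric braid_eqb.
Proof. by move=> u v; apply/asboolP/asboolP; apply: braid_eq_sym. Qed.

Lemma braid_eqb_trans : transitive braid_eqb.
Proof.
by move=> v u w /asboolP uv /asboolP vw; apply/asboolP/(braid_eq_trans uv vw).
Qed.

Canonical braid_equiv :=
  EquivRel braid_eqb braid_eqb_refl braid_eqb_sym braid_eqb_trans.

Definition braid_group : Type := {eq_quot braid_equiv}.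
HB.instance Definition _ := Choice.on braid_group.
HB.instance Definition _ := EqQuotient.on braid_group.

Lemma braid_piP u v :
  \pi_braid_group u = \pi_braid_group v <-> braid_eq u v.
Proof. by split=> [/eqmodP/asboolP|uv]; last exact/eqmodP/asboolP. Qed.

Lemma braid_repr u : braid_eq (repr (\pi_braid_group u)) u.
Proof. by apply/braid_piP; rewrite reprK. Qed.

Definition inv_word (u : seq letter) : seq letter := rev (map inv_letter u).

Lemma inv_wordV u : braid_eq (u ++ inv_word u) [::].
Proof.
elim: u => [|l u IHu]; first exact: braid_eq_refl.
have r := braid_eq_refl; rewrite /inv_word /= rev_cons -cats1 -/(inv_word u).
apply: braid_eq_trans (braid_eq_cancel l).
have := braid_eq_cat (braid_eq_cat (r [:: l]) IHu) (r [:: inv_letter l]).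
by rewrite -!catA.
Qed.

Lemma inv_wordK : involutive inv_word.
Proof.
move=> u; rewrite /inv_word map_rev revK -map_comp -[RHS]map_id.
by apply: eq_map => -[i b]; rewrite /inv_letter /= negbK.
Qed.

Lemma inv_Vword u : braid_eq (inv_word u ++ u) [::].
Proof. by rewrite -{2}[u]inv_wordK; apply: inv_wordV. Qed.

Lemma braid_eq_inv u v : braid_eq u v -> braid_eq (inv_word u) (inv_word v).
Proof.
move=> uv; have r := braid_eq_refl.
apply: (braid_eq_trans (v := inv_word u ++ v ++ inv_word v)).
  rewrite -[X in braid_eq X _]cats0; apply: braid_eq_cat => //.
  exact/braid_eq_sym/inv_wordV.
rewrite catA -[X in braid_eq _ X]cat0s; apply: braid_eq_cat => //.
apply: braid_eq_trans (inv_Vword u); apply: braid_eq_cat => //.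
exact: braid_eq_sym.
Qed.

Definition braid_one : braid_group := \pi_braid_group [::].
Definition braid_mul (x y : braid_group) : braid_group :=
  \pi_braid_group (repr x ++ repr y).
Definition braid_inv (x : braid_group) : braid_group :=
  \pi_braid_group (inv_word (repr x)).

Lemma braid_mulA : associative braid_mul.
Proof.
move=> x y z; apply/braid_piP; have r := braid_eq_refl.
apply: (braid_eq_trans (v := repr x ++ repr y ++ repr z)).
  exact: braid_eq_cat (r _) (braid_repr _).
by rewrite catA; apply: braid_eq_cat (braid_eq_sym (braid_repr _)) (r _).
Qed.

Lemma braid_mul1g : left_id braid_one braid_mul.
Proof.
move=> x; rewrite -[RHS]reprK; apply/braid_piP.
exact: braid_eq_cat (braid_repr [::]) (braid_eq_refl (repr x)).
Qed.

Lemma braid_mulg1 : right_id braid_one braid_mul.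
Proof.
move=> x; rewrite -[RHS]reprK -[X in _ = \pi_braid_group X]cats0.
by apply/braid_piP/braid_eq_cat; [exact: braid_eq_refl | exact: braid_repr].
Qed.

Lemma braid_mulVg : left_inverse braid_one braid_inv braid_mul.
Proof.
move=> x; apply/braid_piP/(braid_eq_trans _ (inv_Vword (repr x))).
exact: braid_eq_cat (braid_repr _) (braid_eq_refl _).
Qed.

Lemma braid_mulgV : right_inverse braid_one braid_inv braid_mul.
Proof.
move=> x; apply/braid_piP/(braid_eq_trans _ (inv_wordV (repr x))).
exact: braid_eq_cat (braid_eq_refl _) (braid_repr _).
Qed.

HB.instance Definition _ := isGroup.Build braid_group
  braid_mulA braid_mul1g braid_mulg1 braid_mulVg braid_mulgV.

(* Indices follow the usual numbering 1, ..., n - 1; sigma i is the identity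
   for any other i. *)
Definition sigma (i : nat) : braid_group :=
  if insub i is Some j then \pi_braid_group [:: (j, false)] else 1.

End BraidGroup.

(* Main.v *)
Require Import Defs.
From mathcomp Require Import all_boot all_classical.

(** Let [x] be one of the two ratios and [K] a normal subgroup of [B'] that
contains [x].

The first point is that [K] contains every conjugate of [x] in the whole braid
group, although [K] is only stable under conjugation by [B'].  All generators
[sigma k] are conjugate, so the braid group is generated by [B'] together with
any single one of them; since [n >= 5], one of them commutes with [x]
(generator 4 for the ratio of 2 and 1, generator 1 for the ratio of 3 and 1).
Hence conjugating [x] by any braid is the same as conjugating it by some
element of [B'] ([conj_by_commutator]).  The normal core of [K] in the braid
group therefore contains [x].

The second point is that a normal subgroup [M] of the braid group that contains
[x] contains [B'].  Modulo [M] the two generators in the ratio agree, so each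
commutes with whatever commutes with the other: generator 2 with generator 1 in
the first case, generator 3 with generator 4 in the second
([commg_congr]).  Thus one pair of adjacent generators commutes modulo [M].  All
such pairs are conjugate ([shift_commg]), so all generators commute modulo [M]
and the quotient by [M] is abelian ([commg_normal]). *)

Local Open Scope group_scope.

(** * Normal subgroups of a group and of its commutator subgroup *)

Section NormalSubgroups.
Variable G : groupType.
Implicit Types (H K M : set G) (a b c g h t x : G).

Let cancelg := (@invgM G, @invgK G, @mulgA G, @mulgK G, @mulgVK G,
                @mulVg G, @mulgV G, @mul1g G, @mulg1 G).

Lemma is_subgroupE H : is_subgroup H <->
  [/\ H 1, forall x y, H x -> H y -> H (x * y) & forall x, H x -> H x^-1].
Proof.
split=> [sH|[H1 HM HV]].
  have [H1 _] := sH; have HM := group_closedM sH; have HV := group_closedV sH.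
  split; first by rewrite inE in H1.
    by move=> x y Hx Hy; have := HM x y; rewrite !inE; apply.
  by move=> x Hx; have := HV x; rewrite !inE; apply.
split; first by rewrite inE.
by move=> x y; rewrite !inE => Hx Hy; apply: HM => //; apply: HV.
Qed.

Lemma commutator_subgroup_is_subgroup : is_subgroup (commutator_subgroup G).
Proof.
apply/is_subgroupE; split=> [|x y Hx Hy|x Hx] H HH; have [sH _] := HH;
  have [H1 HM HV] := (is_subgroupE H).1 sH => //.
- by apply: HM; [apply: Hx | apply: Hy].
- by apply: HV; apply: Hx.
Qed.

Lemma mem_commg a b : commutator_subgroup G [~ a, b].
Proof. by apply: sub_gen_smallest; exists a, b. Qed.

Lemma conjg_commutator_subgroup x g :
  commutator_subgroup G x -> commutator_subgroup G (x ^ g).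
Proof.
have [_ HM _] := (is_subgroupE _).1 commutator_subgroup_is_subgroup.
move=> Hx; rewrite -[x ^ g](mulVKg x) -commgEl.
by apply: HM => //; apply: mem_commg.
Qed.

Lemma commutator_subgroup_normal :
  is_normal_in (commutator_subgroup G) (commutator_subgroup G).
Proof.
split=> //; first exact: commutator_subgroup_is_subgroup.
by move=> x h Hx _; apply: conjg_commutator_subgroup.
Qed.

(** This set is the preimage of the centralizer of the class of [g] in the
quotient of [G] by [M]. *)
Lemma centralizer_mod_subgroup M g :
  is_normal_in setT M -> is_subgroup [set h | M [~ g, h]].
Proof.
move=> [/is_subgroupE[M1 MM MV] _ MJ]; apply/is_subgroupE; split=> /=.
- by rewrite commg1.
- move=> h k Mh Mk.
  have -> : [~ g, h * k] = [~ g, k] * [~ g, h] ^ k.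
    by rewrite !commgEl !conjgE !cancelg.
  by apply: MM => //; apply: MJ.
- move=> h Mh.
  have -> : [~ g, h^-1] = [~ g, h]^-1 ^ h^-1.
    by rewrite !commgEl !conjgE !cancelg.
  by apply: MJ => //; apply: MV.
Qed.

(** The hypothesis on [a * b^-1] says that [a] and [b] coincide modulo [M]. *)
Lemma commg_congr M a b c :
  is_normal_in setT M -> M (a * b^-1) -> commute b c -> M [~ a, c].
Proof.
move=> [/is_subgroupE[_ MM MV] _ MJ] Mab /commgP/conjg_fixP bc.
have -> : [~ a, c] = ((a * b^-1)^-1 * (a * b^-1) ^ c) ^ b.
  by rewrite (conjMg a) (conjVg b) bc commgEl !conjgE !cancelg.
by apply: (MJ) => //; apply: MM; [exact: MV | exact: MJ].
Qed.

Definition core K : set G := [set x | forall g, K (x ^ g)]%classic.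

Lemma core_normal K :
  is_normal_in (commutator_subgroup G) K -> is_normal_in setT (core K).
Proof.
move=> [/is_subgroupE[K1 KM KV] _ KJ]; split=> //.
  apply/is_subgroupE; split=> [g|x y Kx Ky g|x Kx g].
  - by rewrite conj1g.
  - by rewrite conjMg; apply: KM.
  - by rewrite conjVg; apply: KV.
by move=> x h Kx _ g; rewrite -conjgM.
Qed.

Lemma core_sub K : (core K `<=` K)%classic.
Proof. by move=> x /(_ 1); rewrite conjg1. Qed.

(** The elements [g] that act on [x] like an element of the commutator subgroup
form a subgroup.  Each conjugate of [t] belongs to it, because
[t ^ h = t * [~ t, h]] and [t] fixes [x]; so it is all of [G] as soon as the
conjugates of [t] generate [G]. *)
Lemma conj_by_commutator t x :
    commute x t ->
    (forall H, is_subgroup H -> (forall h, H (t ^ h)) -> H = setT) ->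
  forall g, exists2 b, commutator_subgroup G b & x ^ g = x ^ b.
Proof.
move=> /commgP/conjg_fixP xt genG.
pose H : set G :=
  [set g | exists2 b, commutator_subgroup G b & x ^ g = x ^ b]%classic.
have [G1 GM GV] := (is_subgroupE _).1 commutator_subgroup_is_subgroup.
have GJ := conjg_commutator_subgroup.
suff HT : H = setT by move=> g; have : H g by rewrite HT.
apply: genG.
  apply/is_subgroupE; split.
  - by exists 1.
  - move=> g k [b Gb xg] [c Gc xk]; exists (c * b ^ k).
      by apply: GM; auto.
    (* [x ^ (g * k) = x ^ (b * k)], and [b * k = k * b ^ k] *)
    by rewrite !conjgM xg -xk -!conjgM -conjgC.
  - move=> g [b Gb xg]; exists (b ^ g^-1)^-1; first by apply: GV; auto.
    apply: (can_inj (conjgK (b ^ g^-1))); rewrite -!conjgM mulVg conjg1.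
    by rewrite -conjgC conjgM -xg -conjgM mulgV conjg1.
move=> h; exists [~ t, h]; first exact: mem_commg.
by rewrite -{1}[t ^ h](mulVKg t) -commgEl conjgM xt.
Qed.

Lemma mem_core K t x :
    is_normal_in (commutator_subgroup G) K -> K x -> commute x t ->
    (forall H, is_subgroup H -> (forall h, H (t ^ h)) -> H = setT) ->
  core K x.
Proof.
move=> [_ _ KJ] Kx xt genG g.
by have [b Gb ->] := conj_by_commutator _ _ xt genG g; apply: KJ.
Qed.

End NormalSubgroups.

(** * Conjugation and commutation of the braid generators *)

Section BraidGroup.
Variable n : nat.
Local Open Scope quotient_scope.
Local Notation s := (sigma n).
Implicit Types (i j k : nat) (H M : set (braid_group n)).

Lemma pi_cat (u v : seq (letter n)) :
  \pi_(braid_group n) (u ++ v)%SEQ =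
  (\pi_(braid_group n) u : braid_group n) * \pi_(braid_group n) v.
Proof.
by apply/braid_piP/braid_eq_sym/braid_eq_cat; apply: braid_repr.
Qed.

Lemma sigma_gen H :
  is_subgroup H -> (forall i, (0 < i < n)%N -> H (s i)) -> H = setT.
Proof.
move=> /is_subgroupE[H1 HM HV] Hs; apply/seteqP; split=> // x _.
rewrite -[x]reprK; elim: (repr x) => [//|[i b] u IHu].
rewrite -cat1s pi_cat; apply: HM => //.
have Hi : H (\pi_(braid_group n) [:: (i, false)]).
  by have := Hs (val i) (valP i); rewrite /sigma valK.
case: b => //.
have -> : \pi_(braid_group n) [:: (i, true)] =
    (\pi_(braid_group n) [:: (i, false)] : braid_group n)^-1.
  apply/braid_piP; rewrite -[X in braid_eq X _]/(inv_word [:: (i, false)]).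
  exact/braid_eq_inv/braid_eq_sym/braid_repr.
exact: HV.
Qed.

Lemma sigma_braid i : (0 < i)%N -> (i.+1 < n)%N ->
  s i * s i.+1 * s i = s i.+1 * s i * s i.+1.
Proof.
move=> i_gt0 i_lt; have i_in : (0 < i < n)%N by rewrite i_gt0 ltnW.
rewrite /sigma (insubT (fun i => 0 < i < n)%N i_in).
rewrite (insubT (fun i => 0 < i < n)%N (i_lt : 0 < i.+1 < n)%N) -!pi_cat.
exact/braid_piP/braid_eq_braid.
Qed.

Lemma sigma_comm i j : (i.+2 <= j)%N -> commute (s i) (s j).
Proof.
move=> ij; rewrite /sigma.
case: insubP => [u _ ui|_]; last exact/commute_sym/commute1.
case: insubP => [v _ vj|_]; last exact: commute1.
rewrite /commute -!pi_cat; apply/braid_piP/braid_eq_comm.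
by rewrite ui vj ij.
Qed.

Lemma sigma_conj i j : (0 < i < n)%N -> (0 < j < n)%N ->
  exists h, s j = s i ^ h.
Proof.
have conj1 k : (0 < k < n)%N -> exists h, s k = s 1 ^ h.
  elim: k => // -[_ _|k IHk /= lt_kn]; first by exists 1; rewrite conjg1.
  have [|h ek] := IHk; first exact: ltnW.
  (* the braid relation reads [s k.+1 * d = d * s k.+2]
     for [d := s k.+2 * s k.+1] *)
  exists (h * (s k.+2 * s k.+1)); rewrite conjgM -ek.
  apply: (mulgI (s k.+2 * s k.+1)).
  by rewrite -conjgC [RHS]mulgA sigma_braid.
move=> /conj1[h ->] /conj1[k ->].
by exists (h^-1 * k); rewrite conjgM conjgK.
Qed.

Lemma sigma_conj_gen i H : (0 < i < n)%N ->
  is_subgroup H -> (forall h, H (s i ^ h)) -> H = setT.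
Proof.
move=> i_in sH Hi; apply: sigma_gen => // j j_in.
by have [h ->] := sigma_conj _ _ i_in j_in.
Qed.

Lemma sigma_ratio_commutator i j : (0 < i < n)%N -> (0 < j < n)%N ->
  commutator_subgroup (braid_group n) (s i * (s j)^-1).
Proof.
move=> i_in j_in; have [h ->] := sigma_conj _ _ j_in i_in.
have -> : s j ^ h * (s j)^-1 = [~ h, (s j)^-1].
  by rewrite commgEl !conjgE invgK !mulgA.
exact: mem_commg.
Qed.

(** The product of three consecutive generators conjugates the second of them
to the first and the third to the second. *)
Lemma shift_commg i : (0 < i)%N -> (i.+2 < n)%N ->
  [~ s i, s i.+1] = [~ s i.+1, s i.+2] ^ (s i * s i.+1 * s i.+2).
Proof.
move=> i_gt0 lt_i2n; have lt_i1n := ltnW lt_i2n.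
set d := s i * s i.+1 * s i.+2.
have comm2 : s i * s i.+2 = s i.+2 * s i by apply: sigma_comm.
have d1 : s i.+1 * d = d * s i.
  by rewrite /d !mulgA -sigma_braid // -!mulgA comm2.
have d2 : s i.+2 * d = d * s i.+1.
  rewrite /d !mulgA -comm2 -[RHS]mulgA -[RHS]mulgA [s i.+1 * (_ * _)]mulgA.
  by rewrite sigma_braid // !mulgA.
by rewrite conjRg; congr [~ _, _]; apply: (mulgI d); rewrite -conjgC.
Qed.

Lemma commg_adjacent_iff M i : is_normal_in setT M ->
  (0 < i)%N -> (i.+1 < n)%N -> M [~ s i, s i.+1] <-> M [~ s 1, s 2].
Proof.
move=> [_ _ MJ] + lt_i1n; elim: i lt_i1n => // -[//|i] IHi lt_i3n _.
rewrite -IHi //; last exact: ltnW.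
rewrite [in X in _ <-> X]shift_commg //; split=> [Mi|Mi]; first exact: MJ.
by rewrite -[X in M X](conjgK (s i.+1 * s i.+2 * s i.+3)); apply: MJ.
Qed.

(** * Normal subgroups of the braid group with abelian quotient *)

(** Generators at distance at least 2 commute, and adjacent pairs are all
conjugate to the given one; so the generators commute pairwise modulo [M].
Since centralizers modulo [M] are subgroups, this extends to all braids, one
argument of the commutator at a time. *)
Lemma commg_normal M i : is_normal_in setT M ->
    (0 < i)%N -> (i.+1 < n)%N -> M [~ s i, s i.+1] ->
  forall x y, M [~ x, y].
Proof.
move=> nM i_gt0 lt_i1n Mi.
have [/is_subgroupE[M1 _ MV] _ _] := nM.
have Msym x y : M [~ x, y] -> M [~ y, x].
  by rewrite -[[~ y, x]]invgR; apply: MV.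
have lt_comm j k : (0 < j)%N -> (k < n)%N -> (j < k)%N -> M [~ s j, s k].
  move=> j_gt0 lt_kn; rewrite leq_eqVlt => /predU1P[ek|jk].
    rewrite -ek in lt_kn *; apply/(commg_adjacent_iff _ _ nM) => //.
    exact/(commg_adjacent_iff _ _ nM i_gt0 lt_i1n).
  by move: (sigma_comm _ _ jk) => /commgP/eqP ->.
have gens j k : (0 < j < n)%N -> (0 < k < n)%N -> M [~ s j, s k].
  move=> /andP[j_gt0 lt_jn] /andP[k_gt0 lt_kn].
  have [jk|kj|->] := ltngtP j k; last by rewrite commgg.
  - exact: lt_comm.
  - exact/Msym/lt_comm.
have extend g : (forall k, (0 < k < n)%N -> M [~ g, s k]) ->
    forall y, M [~ g, y].
  move=> Mg y; suff gT : [set h | M [~ g, h]]%classic = setT.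
    by have : [set h | M [~ g, h]]%classic y by rewrite gT.
  by apply: sigma_gen; first exact: centralizer_mod_subgroup.
move=> x; apply: (extend) => k k_in; apply: Msym; move: x.
by apply: extend => j; apply: gens.
Qed.

Lemma normal_closure_eq (x : braid_group n) k i :
    (0 < k < n)%N -> (0 < i)%N -> (i.+1 < n)%N ->
    commutator_subgroup (braid_group n) x -> commute x (s k) ->
    (forall M, is_normal_in setT M -> M x -> M [~ s i, s i.+1]) ->
  normal_closure (commutator_subgroup (braid_group n)) x
  = commutator_subgroup (braid_group n).
Proof.
move=> k_in i_gt0 lt_i1n Gx xk Mi; apply/seteqP; split.
  apply: smallest_sub; first exact: commutator_subgroup_normal.
  by move=> _ ->.
move=> y Gy K [nK /(_ _ erefl) Kx]; move: y Gy.
apply: smallest_sub; first by have [] := nK.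
move=> _ [y [z ->]]; apply: core_sub; have nM := core_normal _ _ nK.
apply: (commg_normal _ i nM) => //; apply: Mi => //.
by apply: (mem_core _ _ (s k)) => // H; apply: sigma_conj_gen.
Qed.

End BraidGroup.

Theorem lemma2 (n : nat) (hn : (5 <= n)%N) :
  let B' : set (braid_group n) := commutator_subgroup (braid_group n) in
  normal_closure B' (sigma n 2 * (sigma n 1)^-1) = B' /\
  normal_closure B' (sigma n 3 * (sigma n 1)^-1) = B'.
Proof.
have in_range i : (0 < i <= 4)%N -> (0 < i < n)%N.
  by move=> /andP[-> le_i4]; apply: leq_ltn_trans hn.
have lt_n i : (i <= 4)%N -> (i < n)%N by move=> le_i4; apply: leq_ltn_trans hn.
split.
  apply: (normal_closure_eq n _ 4 1); rewrite ?in_range ?lt_n //.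
  - by apply: sigma_ratio_commutator; apply: in_range.
  - apply/commute_sym/commuteM; last apply: commuteV;
      exact/commute_sym/sigma_comm.
  - move=> M nM Mx.
    have [/is_subgroupE[_ _ MV] _ _] := nM.
    rewrite -invgR; apply: MV; exact: commg_congr nM Mx (commute_refl _).
apply: (normal_closure_eq n _ 1 3); rewrite ?in_range ?lt_n //.
- by apply: sigma_ratio_commutator; apply: in_range.
- apply/commute_sym/commuteM; last exact/commuteV/commute_refl.
  exact: sigma_comm.
- by move=> M nM Mx; apply: commg_congr nM Mx _; apply: sigma_comm.
Qed.
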